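(* Let $a_1,\ldots,a_M\in\mathbb D$, let $b$ be the finite Blaschke product with zeros $a_1,\ldots,a_M$, and let $e_1,\ldots,e_M$ be an orthonormal basis of $\mathbf H_2\ominus b\mathbf H_2$. Let $u=\begin{pmatrix}u_1&\cdots&u_M\end{pmatrix}\in\mathbb C^{1\times M}$ and $\gamma\in\mathbb C$. Set $$v_j=\sum_{\ell=1}^M u_\ell e_j(a_\ell),\quad j=1,\ldots,M,\qquad v=\begin{pmatrix}v_1&v_2&\cdots&v_M\end{pmatrix}\in\mathbb C^{1\times M},$$ and assume $vv^*\neq0$. Let $$B(z)=I_M+(z-1)\frac{v^*v}{vv^*}.$$ Then a function $f\in\mathbf H_2$ satisfies $$\sum_{\ell=1}^M u_\ell f(a_\ell)=\gamma$$ if and only if it can be written as $$f(z)=\frac{\gamma}{vv^*}\sum_{j=1}^M e_j(z)v_j^*+\begin{pmatrix}e_1(z)&e_2(z)&\cdots&e_M(z)\end{pmatrix}B(b(z))\begin{pmatrix}g_1(b(z))\\ g_2(b(z))\\ \vdots\\ g_M(b(z))\end{pmatrix},\qquad z\in\mathbb D,$$ for some $g_1,\ldots,g_M\in\mathbf H_2$.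
   Context: $\mathbb D$ is the open unit disk and $\mathbf H_2$ is the Hardy space of $\mathbb D$: functions $f(z)=\sum_{n\ge 0}f_nz^n$ with $\|f\|_2^2=\sum_{n\ge0}|f_n|^2<\infty$, with the corresponding inner product. The superscript $*$ denotes complex conjugate (of a number) or conjugate transpose (of a matrix). The finite Blaschke product with zeros $a_1,\ldots,a_M$ ($M\ge1$) is $b(z)=\prod_{\ell=1}^M\frac{z-a_\ell}{1-za_\ell^*}$ (up to a unimodular constant). The space $\mathbf H_2\ominus b\mathbf H_2$ is the orthogonal complement of $b\mathbf H_2$ in $\mathbf H_2$; it has dimension $M$. *)

(* Defs.v *)
From HB Require Import structures.
From mathcomp Require Import all_boot all_order all_algebra.
From mathcomp Require Import all_classical all_reals all_analysis.
From mathcomp Require Import complex.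
Import Order.TTheory GRing.Theory Num.Theory numFieldNormedType.Exports.

Set Implicit Arguments.
Unset Strict Implicit.
Unset Printing Implicit Defensive.

Local Open Scope ring_scope.
Local Open Scope sesquilinear_scope.

(* R[i] carries no canonical topology by itself; typing it as a
   numClosedFieldType makes the norm topology of numFieldNormedType available
   on its sort. *)
Definition cplx (R : realType) : numClosedFieldType := R[i].

(* A function in H_2 is given by its square-summable Taylor coefficients at 0;
   hardy_eval recovers its values, which are meaningful only for `|z| < 1. *)
Record hardy (R : realType) := Hardy {
  coef : nat -> cplx R;
  coef_summable :
    (\sum_(0 <= n <oo) ((ComplexField.Normc.normc (coef n)) ^+ 2)%:E < +oo)%E }.

Definition hardy_eval (R : realType) (f : hardy R) (z : cplx R) : cplx R :=
  limn (series (fun n => coef f n * z ^+ n)).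

Coercion hardy_eval : hardy >-> Funclass.

Definition hardy_inner (R : realType) (f g : hardy R) : cplx R :=
  limn (series (fun n => coef f n * (coef g n)^*)).

(* kappa is the unimodular constant up to which a Blaschke product is fixed; the
   zeros a l need not be distinct. *)
Definition blaschke (R : realType) (M : nat) (kappa : cplx R)
    (a : 'I_M -> cplx R) (z : cplx R) : cplx R :=
  kappa * \prod_(l < M) ((z - a l) / (1 - z * (a l)^*)).

(* b H_2: h is compared with b * g on the open disk only. *)
Definition in_multiples (R : realType) (b : cplx R -> cplx R) (h : hardy R) :=
  exists g : hardy R, forall z : cplx R, `|z| < 1 -> h z = b z * g z.

(* H_2 (-) b H_2, the orthogonal complement of b H_2 in H_2. *)
Definition in_model_space (R : realType) (b : cplx R -> cplx R) (h : hardy R) :=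
  forall k : hardy R, in_multiples b k -> hardy_inner h k = 0.

Definition orthonormal_basis (R : realType) (M : nat)
    (K : hardy R -> Prop) (e : 'I_M -> hardy R) :=
  [/\ forall j, K (e j),
      forall i j, hardy_inner (e i) (e j) = (i == j)%:R
    & forall h, K h -> exists c : 'I_M -> cplx R,
        forall z : cplx R, `|z| < 1 -> h z = \sum_(j < M) c j * e j z].

Definition sqnorm_row (R : realType) (M : nat) (v : 'rV[cplx R]_M) : cplx R :=
  (v *m v ^t*) 0 0.

Definition Bmx (R : realType) (M : nat) (v : 'rV[cplx R]_M) (z : cplx R) :
    'M[cplx R]_M :=
  1%:M + ((z - 1) / sqnorm_row v) *: (v ^t* *m v).

(* Main.v *)
(** Multiplication by the Blaschke product b is an isometry T of H_2 with an
    adjoint T' (one Moebius factor at a time), and f - T (T' f) lies in the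
    model space K = H_2 (-) b H_2, whence
      f = \sum_j c_j e_j + b f_1,  |f|^2 = \sum_j |c_j|^2 + |f_1|^2.
    Iterating on f_n = T'^n f gives f = \sum_j e_j h_j(b) with h_j in H_2: the
    remainder b^n f_n tends to 0 pointwise because |b| < 1.  Since b(a_l) = 0,
    the interpolation condition only says that \sum_j v_j h_j(0) = gamma; the
    matrix B(w) is invertible for w <> 0, and B(w) g(w) reaches exactly the h
    whose value at 0 satisfies this constraint (after subtracting the particular
    solution). *)

Require Import Defs.
From HB Require Import structures.
From mathcomp Require Import all_boot all_order all_algebra.
From mathcomp Require Import all_classical all_reals all_analysis.
From mathcomp Require Import complex.
From mathcomp Require Import ring lra.
Import Order.TTheory GRing.Theory Num.Theory numFieldNormedType.Exports.
Set Implicit Arguments.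
Unset Strict Implicit.
Unset Printing Implicit Defensive.
Local Open Scope complex_scope.
Local Open Scope ring_scope.
Local Open Scope classical_set_scope.

(** * Absolutely convergent complex series *)

Section ComplexSeries.
Variable R : realType.
Local Notation C := (cplx R).
Local Notation N := (@ComplexField.Normc.normc R).
Implicit Types (x y : nat -> C) (z c : C).

Lemma normCE z : `|z| = (N z)%:C.
Proof. by case: z. Qed.

Lemma normc_ge0 z : 0 <= N z.
Proof. by rewrite -ler0c -normCE. Qed.

Lemma normcD z c : N (z + c) <= N z + N c.
Proof. by rewrite -lecR; have := ler_normD z c; rewrite !normCE -rmorphD. Qed.

Lemma normc_sum n x : N (\sum_(k < n) x k) <= \sum_(k < n) N (x k).
Proof.
elim: n => [|n IH]; first by rewrite !big_ord0 ComplexField.Normc.normc0.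
by rewrite !big_ord_recr /= (le_trans (normcD _ _)) // lerD2r.
Qed.

Lemma normcX z n : N (z ^+ n) = N z ^+ n.
Proof.
by elim: n => [|n IH]; rewrite ?expr0 ?ComplexField.Normc.normc1 // !exprS
  ComplexField.Normc.normcM IH.
Qed.

Lemma normc_conj z : N (z^* ) = N z.
Proof. by apply: (@complexI R); rewrite -!normCE norm_conjC. Qed.

Lemma normc_lt1 z : (`|z| < 1) = (N z < 1).
Proof. by rewrite normCE -[1 in LHS](rmorph1 (real_complex R)) ltcR. Qed.

Lemma Re_le_normc z : `|complex.Re z| <= N z.
Proof.
by case: z => a b /=; rewrite -sqrtr_sqr ler_wsqrtr // lerDl sqr_ge0.
Qed.

Lemma Im_le_normc z : `|complex.Im z| <= N z.
Proof.
by case: z => a b /=; rewrite -sqrtr_sqr ler_wsqrtr // lerDr sqr_ge0.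
Qed.

Lemma normc_le_ReIm z : N z <= `|complex.Re z| + `|complex.Im z|.
Proof.
case: z => a b /=; rewrite -[leRHS]ger0_norm ?addr_ge0 // -sqrtr_sqr.
rewrite ler_wsqrtr // sqrrD !real_normK ?num_real // lerD2r lerDl.
by rewrite mulrn_wge0 // mulr_ge0.
Qed.

(** Summability is encoded, here and in [l2], by a real bound on all finite partial sums, so that
    estimates reduce to finite sums. *)
Definition abs_summable x := exists K : R, forall n, \sum_(k < n) N (x k) <= K.
Definition l2 x := exists K : R, forall n, \sum_(k < n) N (x k) ^+ 2 <= K.
(** Both [hardy_eval] and [hardy_inner] unfold to this, so the rules below serve point values and
    inner products alike. *)
Definition tsum x : C := limn (series x).

(** The modulus dominates the real and imaginary parts, so both real series converge absolutely;
    their limits are then recombined. *)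
Lemma abs_summable_cvg x : abs_summable x -> cvgn (series x).
Proof.
move=> [K xK].
have real_part (p : C -> R) : (forall z, `|p z| <= N z) ->
    cvgn (series (fun n => p (x n))).
  move=> pN; apply: normed_cvg; apply: nondecreasing_is_cvgn.
    by apply: nondecreasing_series => n _ _; exact: normr_ge0.
  exists K => _ [n _ <-] /=; rewrite seriesEord /=.
  by rewrite (le_trans _ (xK n)) //; apply: ler_sum => i _.
have /cvg_ex[/= lr /cvgrPdist_lt Hr] := real_part _ Re_le_normc.
have /cvg_ex[/= li /cvgrPdist_lt Hi] := real_part _ Im_le_normc.
have ReS n : complex.Re (series x n) = series (fun n => complex.Re (x n)) n.
  rewrite !seriesEord /=; apply: (@big_morph _ _ (@complex.Re R)) => //.
  by move=> [? ?] [? ?].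
have ImS n : complex.Im (series x n) = series (fun n => complex.Im (x n)) n.
  rewrite !seriesEord /=; apply: (@big_morph _ _ (@complex.Im R)) => //.
  by move=> [? ?] [? ?].
suff H : series x @ \oo --> (lr +i* li : C) by exact: (cvgP _ H).
apply/cvgrPdist_lt => eps eps0.
(* In the order of [R[i]] a positive [eps] is real, hence equal to its real part. *)
have eE : eps = (complex.Re eps)%:C by rewrite RRe_real // ger0_real // ltW.
have e0 : 0 < complex.Re eps / 2.
  by move: eps0; rewrite ltcE /= => /andP[_ e0]; lra.
near=> n.
have n1 : `|lr - complex.Re (series x n)| < complex.Re eps / 2
  by rewrite ReS; near: n; exact: Hr.
have n2 : `|li - complex.Im (series x n)| < complex.Re eps / 2
  by rewrite ImS; near: n; exact: Hi.
rewrite normCE eE ltcR (le_lt_trans (normc_le_ReIm _)) //.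
rewrite [ltRHS]splitr ltrD //.
  by move: n1; case: (series x n).
by move: n2; case: (series x n).
Unshelve. all: by end_near. Qed.

Lemma cvg_lipschitz (p : C -> R) (S : nat -> C) (l : C) :
  (forall z c, `|p z - p c| <= N (z - c)) -> S @ \oo --> l ->
  (fun n => p (S n)) @ \oo --> p l.
Proof.
move=> pl /cvgrPdist_lt Sl; apply/cvgrPdist_lt => e e0.
have e0' : (0 : C) < e%:C by rewrite -(rmorph0 (real_complex R)) ltcR.
near=> n.
rewrite (le_lt_trans (pl _ _)) // -ltcR -normCE.
by near: n; exact: Sl.
Unshelve. all: by end_near. Qed.

Lemma normc_dist z c : `|N z - N c| <= N (z - c).
Proof.
rewrite ler_norml; apply/andP; split.
  rewrite lerNl opprB lerBlDr -[N (z - c)]normcN opprB.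
  by rewrite (le_trans _ (normcD _ _)) // subrK.
by rewrite lerBlDr (le_trans _ (normcD _ _)) // subrK.
Qed.

Lemma Re_dist z c : `|complex.Re z - complex.Re c| <= N (z - c).
Proof.
have <- : complex.Re (z - c) = complex.Re z - complex.Re c.
  by case: z c => [? ?] [? ?].
exact: Re_le_normc.
Qed.

Lemma tsum_cvg x : abs_summable x -> series x @ \oo --> tsum x.
Proof. by move=> /abs_summable_cvg. Qed.

Lemma tsum_eq x l : series x @ \oo --> l -> tsum x = l.
Proof. by move=> H; apply: (cvg_lim _ H); exact: norm_hausdorff. Qed.

Lemma normc_tsum_le x K :
  (forall n, \sum_(k < n) N (x k) <= K) -> N (tsum x) <= K.
Proof.
move=> xK.
have /tsum_cvg /(cvg_lipschitz normc_dist) H : abs_summable x by exists K.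
rewrite -(cvg_lim _ H) //; apply: limr_le; first by apply: cvgP H.
near=> n; rewrite seriesEord /=; apply: le_trans (xK n); exact: normc_sum.
Unshelve. all: by end_near. Qed.

(** Partial sums of nonnegative terms increase to the limit. This later bounds finite sums of
    squared coefficients by the inner product of f with itself, which is a complex number. *)
Lemma sum_le_Re_tsum (r : nat -> R) : (forall k, 0 <= r k) ->
  abs_summable (fun k => (r k)%:C : C) -> forall n,
  \sum_(k < n) r k <= complex.Re (tsum (fun k => (r k)%:C : C)).
Proof.
move=> r0 /tsum_cvg /(cvg_lipschitz Re_dist) H n.
have Re_series m : complex.Re (series (fun k => (r k)%:C : C) m) = series r m.
  rewrite !seriesEord /=; apply: (@big_morph _ _ (@complex.Re R)) => //.
  by move=> [? ?] [? ?].
have {}H : series r @ \oo --> complex.Re (tsum (fun k => (r k)%:C : C)).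
  by rewrite -(funext Re_series).
have nd : nondecreasing_seq (series r).
  by apply: nondecreasing_series => k _ _; exact: r0.
have lim_eq : limn (series r) = complex.Re (tsum (fun k => (r k)%:C : C)).
  exact: cvg_lim H.
have := nondecreasing_cvgn_le nd (cvgP _ H) n.
rewrite lim_eq; apply: le_trans.
by rewrite (congr1 (fun s => s n) (seriesEord r)).
Qed.

Lemma eq_tsum x y : x =1 y -> tsum x = tsum y.
Proof. by move=> /funext ->. Qed.

Lemma abs_summableZ c x : abs_summable x -> abs_summable (fun k => c * x k).
Proof.
move=> [K xK]; exists (N c * K) => n.
under eq_bigr do rewrite ComplexField.Normc.normcM.
by rewrite -mulr_sumr ler_wpM2l ?normc_ge0.
Qed.

Lemma tsumD x y : abs_summable x -> abs_summable y ->
  tsum (fun k => x k + y k) = tsum x + tsum y.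
Proof.
move=> /tsum_cvg xs /tsum_cvg ys; apply: tsum_eq.
rewrite (_ : series _ = series x + series y); first exact: cvgD xs ys.
by apply/funext => n; rewrite !seriesEord fctE /= big_split.
Qed.

Lemma tsumZ c x : abs_summable x -> tsum (fun k => c * x k) = c * tsum x.
Proof.
move=> /tsum_cvg xs; apply: tsum_eq.
rewrite (_ : series _ = cst c * series x); first exact: cvgM (cvg_cst c) xs.
by apply/funext => n; rewrite !seriesEord fctE /= mulr_sumr.
Qed.

Lemma tsum0 : tsum (fun _ => 0) = 0 :> C.
Proof.
apply: tsum_eq; rewrite seriesEord; under eq_fun do rewrite big1 //.
exact: cvg_cst.
Qed.

Lemma tsum_conj x : abs_summable x -> tsum (fun k => (x k)^* ) = (tsum x)^*.
Proof.
move=> /tsum_cvg /cvgrPdist_lt xs; apply: tsum_eq; apply/cvgrPdist_lt => e e0.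
near=> n.
have -> : series (fun k => (x k)^* ) n = (series x n)^*.
  by rewrite !seriesEord /= rmorph_sum.
by rewrite -rmorphB norm_conjC; near: n; exact: xs.
Unshelve. all: by end_near. Qed.

Lemma tsum_recl x : abs_summable x -> tsum x = x 0%N + tsum (fun k => x k.+1).
Proof.
move=> xs.
have [K xK] := xs.
have ts : abs_summable (fun k => x k.+1).
  exists K => n; apply: le_trans (xK n.+1).
  by rewrite big_ord_recl /= lerDr normc_ge0.
apply: (tsum_eq (x := x)).
rewrite -(cvg_shiftS (series x)).
rewrite (_ : (fun n => series x n.+1) =
             cst (x 0%N) + series (fun k => x k.+1)).
  exact: cvgD (cvg_cst (x 0%N)) (tsum_cvg ts).
by apply/funext => n; rewrite !seriesEord fctE /= big_ord_recl.
Qed.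

End ComplexSeries.

(** * Square-summable sequences and the space H_2 *)

Section Hardy.
Variable R : realType.
Local Notation C := (cplx R).
Local Notation N := (@ComplexField.Normc.normc R).
Implicit Types (x y : nat -> C) (z c w : C) (f g h : hardy R).

Lemma coef_l2 f : l2 (coef f).
Proof.
case: f => x /= xoo; set s := (\sum_(0 <= n <oo) _)%E in xoo.
have s_ge n : ((\sum_(k < n) N (x k) ^+ 2)%:E <= s)%E.
  rewrite -sumEFin -(big_mkord predT (fun k => (N (x k) ^+ 2)%:E)).
  by apply: nneseries_lim_ge => k _ _; rewrite lee_fin sqr_ge0.
exists (fine s) => n; rewrite -lee_fin fineK //.
rewrite ge0_fin_numE //; apply: le_trans (s_ge 0%N).
by rewrite big_ord0.
Qed.

Lemma l2_nneseries x : l2 x ->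
  (\sum_(0 <= n <oo) ((N (x n)) ^+ 2)%:E < +oo)%E.
Proof.
move=> [K xK]; apply: (@le_lt_trans _ _ K%:E); last exact: ltry.
apply: lime_le.
  by apply: is_cvg_nneseries => n _ _; rewrite lee_fin sqr_ge0.
by apply: nearW => n; rewrite big_mkord sumEFin lee_fin.
Qed.

Definition hardy_of x (xl : l2 x) : hardy R := Hardy (l2_nneseries xl).

Lemma sum_geometric_le (r : R) n : 0 <= r < 1 ->
  \sum_(k < n) r ^+ k <= (1 - r)^-1.
Proof.
move=> /andP[r0 r1].
have E : (\sum_(k < n) r ^+ k) * (1 - r) = 1 - r ^+ n.
  elim: n => [|n IH]; first by rewrite big_ord0 mul0r expr0 subrr.
  by rewrite big_ord_recr /= mulrDl IH exprS; ring.
rewrite -[leRHS]mul1r ler_pdivlMr ?subr_gt0 // E.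
by rewrite gerBl exprn_ge0.
Qed.

Lemma sum_sqr_geometric_le z n : N z < 1 ->
  \sum_(k < n) N (z ^+ k) ^+ 2 <= (1 - N z ^+ 2)^-1.
Proof.
move=> z1; under eq_bigr do rewrite normcX exprAC.
by rewrite sum_geometric_le // sqr_ge0 /= expr_lt1 // normc_ge0.
Qed.

Lemma l2_geometric z : N z < 1 -> l2 (fun n => z ^+ n).
Proof.
by move=> z1; exists (1 - N z ^+ 2)^-1 => n; exact: sum_sqr_geometric_le.
Qed.

(** The termwise inequality 2 s t <= s^2 + t^2 takes the place of Cauchy-Schwarz; only boundedness
    matters in the sequel. *)
Lemma sum_normcM_le x y K L n :
  \sum_(k < n) N (x k) ^+ 2 <= K -> \sum_(k < n) N (y k) ^+ 2 <= L ->
  \sum_(k < n) N (x k * y k) <= (K + L) / 2.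
Proof.
move=> xK yL.
have : \sum_(k < n) N (x k * y k) <=
    \sum_(k < n) (N (x k) ^+ 2 + N (y k) ^+ 2) / 2.
  apply: ler_sum => i _; rewrite ComplexField.Normc.normcM.
  have := sqr_ge0 (N (x i) - N (y i)); lra.
rewrite -mulr_suml big_split /=; lra.
Qed.

Lemma l2M x y : l2 x -> l2 y -> abs_summable (fun k => x k * y k).
Proof.
by move=> [K xK] [L yL]; exists ((K + L) / 2) => n; exact: sum_normcM_le.
Qed.

Lemma l2_conj x : l2 x -> l2 (fun k => (x k)^* ).
Proof.
by move=> [K xK]; exists K => n; under eq_bigr do rewrite normc_conj.
Qed.

Lemma l2_lin c x y : l2 x -> l2 y -> l2 (fun k => c * x k + y k).
Proof.
move=> [K xK] [L yL]; exists (2 * N c ^+ 2 * K + 2 * L) => n.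
apply: (@le_trans _ _
  (\sum_(k < n) (2 * N c ^+ 2 * N (x k) ^+ 2 + 2 * N (y k) ^+ 2))).
  apply: ler_sum => i _.
  have h := normcD (c * x i) (y i).
  have h0 := normc_ge0 (c * x i + y i).
  apply: le_trans (_ : (N (c * x i) + N (y i)) ^+ 2 <= _).
    by rewrite ler_sqr ?nnegrE // (le_trans h0 h).
  rewrite ComplexField.Normc.normcM -mulrA -exprMn.
  have := sqr_ge0 (N c * N (x i) - N (y i)); lra.
rewrite big_split /= -!mulr_sumr; apply: lerD; apply: ler_wpM2l;
  rewrite ?xK ?yL //.
by rewrite mulr_ge0 // sqr_ge0.
Qed.

Lemma l2_0 : l2 (fun _ => 0 : C).
Proof.
exists 0 => n; rewrite big1 // => i _.
by rewrite ComplexField.Normc.normc0 expr0n.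
Qed.

Lemma l2_sum (M : nat) (u : 'I_M -> C) (X : 'I_M -> nat -> C) :
  (forall j, l2 (X j)) -> l2 (fun k => \sum_(j < M) u j * X j k).
Proof.
elim: M u X => [|M IH] u X Xl.
  by under [X in l2 X]eq_fun do rewrite big_ord0; exact: l2_0.
under [X in l2 X]eq_fun do rewrite big_ord_recl.
by apply: l2_lin => //; apply: IH.
Qed.

Definition shift x (n : nat) : C := if n is m.+1 then x m else 0.

Lemma l2_shift x : l2 x -> l2 (shift x).
Proof.
move=> [K xK]; exists K => -[|n].
  by rewrite big_ord0 (le_trans _ (xK 0%N)) // big_ord0.
rewrite big_ord_recl.
by rewrite (_ : N (shift x _) = 0) ?expr0n ?add0r //;
  exact: ComplexField.Normc.normc0.
Qed.

Lemma l2_bshift x : l2 x -> l2 (fun k => x k.+1).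
Proof.
move=> [K xK]; exists K => n; apply: le_trans (xK n.+1).
by rewrite big_ord_recl /= lerDr sqr_ge0.
Qed.

(** * Linear combinations, shift and backward shift on H_2 *)

Definition hlin c f g : hardy R := hardy_of (l2_lin c (coef_l2 f) (coef_l2 g)).
Definition hzero : hardy R := hardy_of l2_0.
Definition hsum (M : nat) (u : 'I_M -> C) (f : 'I_M -> hardy R) : hardy R :=
  hardy_of (l2_sum u (fun j => coef_l2 (f j))).
Definition hshift f : hardy R := hardy_of (l2_shift (coef_l2 f)).
Definition hbshift f : hardy R := hardy_of (l2_bshift (coef_l2 f)).

Lemma abs_summable_inner f g : abs_summable (fun k => coef f k * (coef g k)^* ).
Proof. exact: l2M (coef_l2 f) (l2_conj (coef_l2 g)). Qed.

Lemma abs_summable_eval f z : N z < 1 ->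
  abs_summable (fun k => coef f k * z ^+ k).
Proof. by move=> z1; exact: l2M (coef_l2 f) (l2_geometric z1). Qed.

Lemma eval_ext f g : coef f =1 coef g -> forall z, f z = g z.
Proof. by move=> fg z; apply: eq_tsum => k; rewrite fg. Qed.

Lemma inner_ext f f' g g' : coef f =1 coef f' -> coef g =1 coef g' ->
  hardy_inner f g = hardy_inner f' g'.
Proof. by move=> ff gg; apply: eq_tsum => k; rewrite ff gg. Qed.

Lemma inner_conj f g : (hardy_inner f g)^* = hardy_inner g f.
Proof.
rewrite -[hardy_inner f g]/(tsum _) -tsum_conj; last exact: abs_summable_inner.
by apply: eq_tsum => k; rewrite rmorphM /= conjCK mulrC.
Qed.

Lemma inner_linl c f g h :
  hardy_inner (hlin c f g) h = c * hardy_inner f h + hardy_inner g h.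
Proof.
have fh := abs_summable_inner f h.
rewrite -tsumZ // -tsumD;
  [|exact: abs_summableZ|exact: abs_summable_inner].
by apply: eq_tsum => k /=; rewrite mulrDl mulrA.
Qed.

Lemma inner_linr c f g h :
  hardy_inner h (hlin c f g) = c^* * hardy_inner h f + hardy_inner h g.
Proof. by rewrite -inner_conj inner_linl rmorphD rmorphM /= !inner_conj. Qed.

Lemma eval_lin c f g z : N z < 1 -> hlin c f g z = c * f z + g z.
Proof.
move=> z1; have fz := abs_summable_eval f z1.
rewrite -[f z]/(tsum _) -tsumZ // -tsumD;
  [|exact: abs_summableZ|exact: abs_summable_eval].
by apply: eq_tsum => k /=; rewrite mulrDl mulrA.
Qed.

Lemma inner0l f : hardy_inner hzero f = 0.
Proof. by rewrite -(tsum0 R); apply: eq_tsum => k; rewrite mul0r. Qed.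

Lemma eval0 z : hzero z = 0.
Proof. by rewrite -(tsum0 R); apply: eq_tsum => k; rewrite mul0r. Qed.

Lemma hsum_recl (M : nat) (u : 'I_M.+1 -> C) (f : 'I_M.+1 -> hardy R) :
  coef (hsum u f) =1
  coef (hlin (u ord0) (f ord0)
    (hsum (fun j => u (lift ord0 j)) (fun j => f (lift ord0 j)))).
Proof. by move=> k /=; rewrite big_ord_recl. Qed.

Lemma inner_suml (M : nat) (u : 'I_M -> C) (f : 'I_M -> hardy R) h :
  hardy_inner (hsum u f) h = \sum_(j < M) u j * hardy_inner (f j) h.
Proof.
elim: M u f => [|M IH] u f.
  rewrite big_ord0 -(inner0l h); apply: inner_ext => // k /=.
  by rewrite big_ord0.
rewrite (inner_ext (hsum_recl u f) (frefl _)) inner_linl IH.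
by rewrite [RHS]big_ord_recl.
Qed.

Lemma eval_sum (M : nat) (u : 'I_M -> C) (f : 'I_M -> hardy R) z : N z < 1 ->
  hsum u f z = \sum_(j < M) u j * f j z.
Proof.
move=> z1; elim: M u f => [|M IH] u f.
  rewrite big_ord0 -(eval0 z); apply: eval_ext => // k /=.
  by rewrite big_ord0.
rewrite (eval_ext (hsum_recl u f)) eval_lin // IH.
by rewrite [RHS]big_ord_recl.
Qed.

Lemma eval_recl f z : N z < 1 -> f z = coef f 0%N + z * hbshift f z.
Proof.
move=> z1; rewrite -[f z]/(tsum _) tsum_recl; last exact: abs_summable_eval.
rewrite expr0 mulr1 -[hbshift f z]/(tsum _) -tsumZ;
  last exact: abs_summable_eval.
by congr (_ + _); apply: eq_tsum => k /=; rewrite exprS mulrCA.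
Qed.

Lemma eval_at0 f : f 0 = coef f 0%N.
Proof. by rewrite eval_recl ?mul0r ?addr0 // ComplexField.Normc.normc0. Qed.

Lemma eval_shift f z : N z < 1 -> hshift f z = z * f z.
Proof.
by move=> z1; rewrite eval_recl //= add0r; congr (_ * _); apply: eval_ext.
Qed.

Lemma inner_shift f g : hardy_inner (hshift f) g = hardy_inner f (hbshift g).
Proof.
rewrite -[LHS]/(tsum _) tsum_recl; last exact: abs_summable_inner.
by rewrite /= mul0r add0r.
Qed.

Lemma inner_shift_shift f g :
  hardy_inner (hshift f) (hshift g) = hardy_inner f g.
Proof. by rewrite inner_shift; apply: inner_ext. Qed.

(** * Bounds on point values and uniqueness of Taylor coefficients *)

Lemma normc_eval_le f z K : (forall n, \sum_(k < n) N (coef f k) ^+ 2 <= K) ->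
  N z < 1 -> N (f z) <= (K + (1 - N z ^+ 2)^-1) / 2.
Proof.
move=> fK z1; apply: normc_tsum_le => n; apply: sum_normcM_le => //.
exact: sum_sqr_geometric_le.
Qed.

(** For small real t > 0, f(t) = 0 says that the constant coefficient is -t times the value at t of
    the backward shift of f, which stays bounded; let t tend to 0. The point 0 is excluded because
    dividing by z in the later induction loses it. *)
Lemma coef0_of_punctured_zero f :
  (forall z, N z < 1 -> z != 0 -> f z = 0) -> coef f 0%N = 0.
Proof.
move=> f0; have [K fK] := coef_l2 (hbshift f).
(* The bound of [normc_eval_le] for t <= 1/2, where 1 / (1 - t^2) <= 4/3. *)
set B := (K + 4 / 3) / 2.
have f0_le (t : R) : 0 < t <= 1 / 2 -> N (coef f 0%N) <= t * B.
  move=> /andP[t0 t2].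
  have Nt : N (t%:C : C) = t by rewrite /= expr0n addr0 sqrtr_sqr gtr0_norm.
  have t1 : N (t%:C : C) < 1 by rewrite Nt; lra.
  have tn0 : (t%:C : C) != 0 by rewrite eq_complex /= eqxx andbT gt_eqF.
  have := f0 _ t1 tn0; rewrite eval_recl // => /eqP.
  rewrite addr_eq0 => /eqP ->; rewrite normcN ComplexField.Normc.normcM Nt.
  rewrite ler_wpM2l ?(ltW t0) //.
  apply: le_trans (normc_eval_le fK t1) _; rewrite Nt /B.
  suff : (1 - t ^+ 2)^-1 <= 4 / 3 by lra.
  by rewrite -[leRHS]invf_div lef_pV2 ?posrE; nra.
apply: ComplexField.Normc.eq0_normc; apply/eqP; rewrite eq_le normc_ge0 andbT.
have B0 : 0 <= B.
  have := f0_le (1 / 2) _; have := normc_ge0 (coef f 0%N); lra.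
rewrite leNgt; apply/negP => p0; set p := N _ in p0.
(* This t makes t * B < p, a contradiction; B + 1 keeps the denominator positive when B = 0. *)
have := f0_le (Num.min (1 / 2) (p / (B + 1) / 2)) _.
rewrite lt_min ge_min lexx /= !divr_gt0 // ?ltr_wpDl // => /(_ isT).
rewrite -/p leNgt => /negP; apply.
apply: (@le_lt_trans _ _ (p / (B + 1) / 2 * B)).
  by rewrite ler_wpM2r // ge_min lexx orbT.
rewrite -subr_gt0.
have -> : p - p / (B + 1) / 2 * B = p * (1 - B / (B + 1) / 2) by ring.
rewrite mulr_gt0 // subr_gt0.
have : B / (B + 1) <= 1 by rewrite ler_pdivrMr; lra.
lra.
Qed.

Lemma coef_eq0 f : (forall z, N z < 1 -> f z = 0) -> coef f =1 (fun=> 0).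
Proof.
move=> f0.
have {f0} : forall z, N z < 1 -> z != 0 -> f z = 0 by move=> z z1 _; exact: f0.
move=> + n; elim: n f => [|n IH] f f0; first exact: coef0_of_punctured_zero.
apply: (IH (hbshift f)) => z z1 zn0; have := f0 z z1 zn0.
rewrite eval_recl // coef0_of_punctured_zero // add0r => /eqP.
by rewrite mulf_eq0 (negbTE zn0) => /eqP.
Qed.

(** Turns identities between functions on the disk into identities of coefficients, and so of inner
    products. *)
Lemma coef_inj f g : (forall z, N z < 1 -> f z = g z) -> coef f =1 coef g.
Proof.
move=> fg n.
have H z : N z < 1 -> hlin (-1) f g z = 0.
  by move=> z1; rewrite eval_lin // fg // mulN1r addNr.
by have /eqP := coef_eq0 H n; rewrite /= mulN1r addrC subr_eq0 => /eqP.
Qed.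

End Hardy.

(** * Resolvents of the shifts, and isometric multiplication by Blaschke products *)

Section Multipliers.
Variable R : realType.
Local Notation C := (cplx R).
Local Notation N := (@ComplexField.Normc.normc R).
Implicit Types (x y : nat -> C) (z c w : C) (f g h : hardy R).

(** Convexity of the square, applied to |c| and |z| / (1 - |w|) with weights |w| and 1 - |w|. The
    factor |w| < 1 makes the recursions below contract. *)
Lemma sqr_normc_convex w c z : N w < 1 ->
  N (w * c + z) ^+ 2 <= N w * N c ^+ 2 + N z ^+ 2 / (1 - N w).
Proof.
move=> w1; have w0 := normc_ge0 w.
apply: (@le_trans _ _ ((N w * N c + N z) ^+ 2)).
  have h := normcD (w * c) z; rewrite ComplexField.Normc.normcM in h.
  by rewrite ler_sqr ?nnegrE // ?(le_trans _ h) // normc_ge0.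
rewrite -subr_ge0.
have -> : N w * N c ^+ 2 + N z ^+ 2 / (1 - N w) - (N w * N c + N z) ^+ 2 =
    N w / (1 - N w) * ((1 - N w) * N c - N z) ^+ 2 by field; lra.
by rewrite mulr_ge0 ?sqr_ge0 // divr_ge0 // subr_ge0 ltW.
Qed.

(* Coefficients of f / (1 - w z). *)
Fixpoint resolvent_seq w x (n : nat) : C :=
  if n is m.+1 then w * resolvent_seq w x m + x n else x 0%N.

Lemma l2_resolvent_seq w x : N w < 1 -> l2 x -> l2 (resolvent_seq w x).
Proof.
move=> w1 [K xK]; set q := resolvent_seq w x.
have w0 := normc_ge0 w.
have K' : 0 <= K by have := xK 0%N; rewrite big_ord0.
(* The partial sums satisfy S_(m+1) <= |w| S_m + L with L = K + K / (1 - |w|); since S_m <= S_(m+1),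
   each is at most L / (1 - |w|). *)
exists ((K + K / (1 - N w)) / (1 - N w)) => n.
rewrite ler_pdivlMr ?subr_gt0 //.
have step m : \sum_(k < m.+1) N (q k) ^+ 2 <=
    N w * (\sum_(k < m) N (q k) ^+ 2) + (K + K / (1 - N w)).
  rewrite big_ord_recl /=.
  have x0 : N (x 0%N) ^+ 2 <= K by have := xK 1%N; rewrite big_ord1.
  have xS : \sum_(k < m) N (x k.+1) ^+ 2 <= K.
    by apply: le_trans (xK m.+1); rewrite big_ord_recl lerDr sqr_ge0.
  apply: (@le_trans _ _ (N (x 0%N) ^+ 2 +
      \sum_(k < m) (N w * N (q k) ^+ 2 + N (x k.+1) ^+ 2 / (1 - N w)))).
    by rewrite lerD2l; apply: ler_sum => k _; exact: sqr_normc_convex.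
  rewrite big_split /= -mulr_sumr -mulr_suml addrCA lerD2l lerD //.
  by rewrite ler_wpM2r // invr_ge0 subr_ge0 ltW.
case: n => [|n].
  by rewrite big_ord0 mul0r addr_ge0 // divr_ge0 // subr_ge0 ltW.
have := step n.
have : \sum_(k < n) N (q k) ^+ 2 <= \sum_(k < n.+1) N (q k) ^+ 2.
  by rewrite big_ord_recr /= lerDl sqr_ge0.
set S := \sum_(k < n) _; set S' := \sum_(k < n.+1) _ => SS' stp.
have : N w * S <= N w * S' by rewrite ler_wpM2l.
nra.
Qed.

(** Provides division by 1 - w z inside H_2, needed for the denominator of a Moebius factor. *)
Lemma forward_resolvent w f : N w < 1 -> exists g : hardy R,
  coef (hlin (- w) (hshift g) g) =1 coef f.
Proof.
move=> w1; exists (hardy_of (l2_resolvent_seq w1 (coef_l2 f))) => -[|n] /=.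
  by rewrite mulr0 add0r.
by rewrite addrA mulNr addNr add0r.
Qed.

(* Solves (1 - w S* ) g = f for the backward shift S*; the solution is
   g_n = \sum_m w^m f_(n + m), i.e. the value at w of the n-th backward shift
   of f. *)
Lemma backward_resolvent w f : N w < 1 -> exists g : hardy R,
  coef (hlin (- w) (hbshift g) g) =1 coef f.
Proof.
move=> w1; have [K fK] := coef_l2 f.
pose t n : hardy R := iter n (@hbshift R) f.
have coef_t n k : coef (t n) k = coef f (n + k)%N.
  by elim: n k => [|n IH] k //=; rewrite IH addnS.
pose r n : C := t n w.
have r_rec n : r n = w * r n.+1 + coef f n.
  by rewrite /r eval_recl // coef_t addn0 addrC.
have tK n m : \sum_(k < m) N (coef (t n) k) ^+ 2 <= K.
  apply: le_trans (fK (n + m)%N); rewrite big_split_ord /=.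
  under eq_bigr do rewrite coef_t.
  by rewrite lerDr sumr_ge0 // => k _; rewrite sqr_ge0.
have w0 := normc_ge0 w.
set B := (K + (1 - N w ^+ 2)^-1) / 2.
have rB n : N (r n) <= B by exact: normc_eval_le (tK n) w1.
have rl2 : l2 r.
  (* Here [r_rec] bounds each term by the next one, so a boundary term |w| |r_n|^2 remains; the
     uniform bound [rB] absorbs it into B^2. *)
  exists ((B ^+ 2 + K / (1 - N w)) / (1 - N w)) => n.
  rewrite ler_pdivlMr ?subr_gt0 //.
  have : \sum_(k < n) N (r k) ^+ 2 <=
      N w * (\sum_(k < n.+1) N (r k) ^+ 2) + K / (1 - N w).
    apply: (@le_trans _ _
        (\sum_(k < n) (N w * N (r k.+1) ^+ 2 + N (coef f k) ^+ 2 / (1 - N w)))).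
      by apply: ler_sum => k _; rewrite {1}r_rec; exact: sqr_normc_convex.
    rewrite big_split /= -mulr_sumr -mulr_suml lerD //.
      by rewrite ler_wpM2l // big_ord_recl lerDr sqr_ge0.
    by rewrite ler_wpM2r ?fK // invr_ge0 subr_ge0 ltW.
  rewrite big_ord_recr /=; set S := \sum_(k < n) _ => stp.
  have rB2 : N (r n) ^+ 2 <= B ^+ 2.
    by rewrite ler_sqr ?nnegrE ?normc_ge0 // (le_trans (normc_ge0 _) (rB n)).
  have : N w * N (r n) ^+ 2 <= B ^+ 2.
    by apply: le_trans rB2; rewrite ler_piMl ?sqr_ge0 // ltW.
  nra.
exists (hardy_of rl2) => n /=.
by rewrite [X in _ + X]r_rec addrA mulNr addNr add0r.
Qed.

(* T is multiplication by phi and T' its adjoint. *)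
Definition inner_multiplier (phi : C -> C) :=
  exists T T' : hardy R -> hardy R,
    [/\ forall f z, N z < 1 -> T f z = phi z * f z,
        forall f g, hardy_inner (T f) (T g) = hardy_inner f g
      & forall f g, hardy_inner f (T g) = hardy_inner (T' f) g].

Lemma inner_multiplier_ext phi psi :
  phi =1 psi -> inner_multiplier phi -> inner_multiplier psi.
Proof. by move=> /funext ->. Qed.

Lemma inner_multiplierM phi psi : inner_multiplier phi ->
  inner_multiplier psi -> inner_multiplier (fun z => phi z * psi z).
Proof.
move=> [T [T' [Te Ti Ta]]] [S [S' [Se Si Sa]]].
exists (T \o S), (S' \o T'); split => /=.
- by move=> f z z1; rewrite Te // Se // mulrA.
- by move=> f g; rewrite Ti Si.
- by move=> f g; rewrite Ta Sa.
Qed.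

Lemma inner_multiplier_cst kappa :
  N kappa = 1 -> inner_multiplier (fun=> kappa).
Proof.
move=> k1.
exists (fun f => hlin kappa f (hzero R)), (fun f => hlin kappa^* f (hzero R)).
have inner0r f : hardy_inner f (hzero R) = 0.
  by rewrite -inner_conj inner0l rmorph0.
split.
- by move=> f z z1; rewrite eval_lin // eval0 addr0.
- move=> f g; rewrite inner_linl inner_linr inner0l inner0r !addr0 mulrA.
  by rewrite -normCK normCE k1 expr1n mul1r.
- by move=> f g; rewrite inner_linl inner_linr inner0l inner0r.
Qed.

Lemma inner_multiplier_factor a : N a < 1 ->
  inner_multiplier (fun z => (z - a) / (1 - z * a^* )).
Proof.
move=> a1; have ac1 : N a^* < 1 by rewrite normc_conj.
have [Q HQ] := choice (fun f => forward_resolvent f ac1).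
have [P HP] := choice (fun f => backward_resolvent f a1).
(* T = (S - a) (1 - a^* S)^-1, so T' = (1 - a S* )^-1 (S* - a^* ). *)
pose T f := hlin (- a) (Q f) (hshift (Q f)).
exists T, (fun f => P (hlin (- a^* ) f (hbshift f))).
have conjN (c : C) : (- c)^* = - c^* by rewrite rmorphN.
split.
- move=> f z z1; rewrite /T eval_lin // eval_shift //.
  rewrite -(eval_ext (HQ f)) eval_lin // eval_shift //.
  have nz : 1 - z * a^* != 0.
    rewrite subr_eq0; apply/eqP => /(congr1 N).
    rewrite ComplexField.Normc.normc1 ComplexField.Normc.normcM normc_conj => E.
    have := normc_ge0 z; have := normc_ge0 a; nra.
  by field.
(* With S the shift, S - a and 1 - a^* S give the same inner products: S is isometric, and the cross
   terms agree. *)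
- move=> f g; rewrite -[RHS](inner_ext (HQ f) (HQ g)) /T.
  rewrite !(inner_linl, inner_linr) !conjN !conjCK !inner_shift_shift.
  by ring.
- move=> f g; rewrite -[in RHS](inner_ext (frefl _) (HQ g)).
  set r := P _; set q := Q g.
  (* Moving 1 - a^* S to the left argument yields its adjoint, which cancels the resolvent [P] in
     [r]. *)
  have -> : hardy_inner r (hlin (- a^* ) (hshift q) q) =
      hardy_inner (hlin (- a) (hbshift r) r) q.
    rewrite inner_linl inner_linr conjN conjCK.
    by rewrite -[hardy_inner r (hshift q)]inner_conj inner_shift inner_conj.
  rewrite (inner_ext (HP _) (frefl _)) inner_linl inner_linr conjN.
  by rewrite -[hardy_inner f (hshift q)]inner_conj inner_shift inner_conj.
Qed.

Lemma inner_multiplier_blaschke (M : nat) kappa (a : 'I_M -> C) :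
  N kappa = 1 -> (forall l, N (a l) < 1) ->
  inner_multiplier (blaschke kappa a).
Proof.
move=> k1 a1; apply: inner_multiplierM (inner_multiplier_cst k1) _.
elim: M a a1 => [|M IH] a a1.
  apply: inner_multiplier_ext
    (inner_multiplier_cst (ComplexField.Normc.normc1 R)).
  by move=> z; rewrite big_ord0.
have := inner_multiplierM (inner_multiplier_factor (a1 ord0))
  (IH _ (fun l => a1 (lift ord0 l))).
by apply: inner_multiplier_ext => z; rewrite big_ord_recl.
Qed.

(** One factor, present because M > 0, gives the strict inequality; the others have modulus at most
    1. *)
Lemma blaschke_lt1 (M : nat) kappa (a : 'I_M -> C) z : (0 < M)%N ->
  N kappa = 1 -> (forall l, N (a l) < 1) -> N z < 1 ->
  N (blaschke kappa a z) < 1.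
Proof.
move=> M0 k1 a1 z1.
have factor_lt1 c : N c < 1 -> N ((z - c) / (1 - z * c^* )) < 1.
  move=> c1.
  have nz : 1 - z * c^* != 0.
    rewrite subr_eq0; apply/eqP => /(congr1 N).
    rewrite ComplexField.Normc.normc1 ComplexField.Normc.normcM normc_conj => E.
    have := normc_ge0 z; have := normc_ge0 c; nra.
  rewrite -normc_lt1 normrM normrV ?unitfE // ltr_pdivrMr ?normr_gt0 // mul1r.
  rewrite -ltr_sqr ?nnegrE // -subr_gt0.
  have -> : `|1 - z * c^*| ^+ 2 - `|z - c| ^+ 2 =
      (1 - `|z| ^+ 2) * (1 - `|c| ^+ 2).
    by rewrite !normCK !(rmorphB, rmorphM) /= rmorph1 conjCK; ring.
  by rewrite mulr_gt0 // subr_gt0 expr_lt1 // normc_lt1.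
case: M a M0 a1 => // M a _ a1; rewrite /blaschke.
rewrite ComplexField.Normc.normcM k1 mul1r big_ord_recl.
rewrite ComplexField.Normc.normcM.
set p := \prod_(i < M) _.
have p1 : N p <= 1.
  rewrite /p; elim/big_ind: _ => [|x y x1 y1|i _].
  - by rewrite ComplexField.Normc.normc1.
  - by rewrite ComplexField.Normc.normcM mulr_ile1 // normc_ge0.
  - by rewrite ltW // factor_lt1.
have := factor_lt1 _ (a1 ord0); have := normc_ge0 p.
have := normc_ge0 ((z - a ord0) / (1 - z * (a ord0)^* )); nra.
Qed.

Lemma blaschke_zero (M : nat) kappa (a : 'I_M -> C) l :
  blaschke kappa a (a l) = 0.
Proof. by rewrite /blaschke (bigD1 l) //= subrr mul0r mul0r mulr0. Qed.

End Multipliers.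

(** * Expansion of H_2 functions along the model space *)

Section ModelSpace.
Variable R : realType.
Local Notation C := (cplx R).
Local Notation N := (@ComplexField.Normc.normc R).
Implicit Types (x y : nat -> C) (z c w : C) (f g h : hardy R).

Lemma sum_normc_le_inner f n :
  \sum_(k < n) N (coef f k) ^+ 2 <= complex.Re (hardy_inner f f).
Proof.
have sE : (fun k => coef f k * (coef f k)^* ) =1
    (fun k => (N (coef f k) ^+ 2)%:C : C).
  by move=> k; rewrite -normCK normCE -rmorphXn.
rewrite -[hardy_inner f f]/(tsum _) (eq_tsum sE); apply: sum_le_Re_tsum => [k|].
  exact: sqr_ge0.
by rewrite -(funext sE); exact: abs_summable_inner.
Qed.

(** The n-th Taylor coefficient of [h j] is the j-th coordinate of the model-space component of T'^n
    f. *)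
Lemma model_space_expansion (b : C -> C) (M : nat) (e : 'I_M -> hardy R) f :
  inner_multiplier b -> (forall z, N z < 1 -> N (b z) < 1) ->
  orthonormal_basis (in_model_space b) e ->
  exists h : 'I_M -> hardy R, forall z, N z < 1 ->
    f z = \sum_(j < M) e j z * h j (b z).
Proof.
move=> [T [T' [Te Ti Ta]]] b1 [eK eo eb].
pose p f := hlin (-1) (T (T' f)) f.
have pK g : in_model_space b (p g).
  move=> k [k' kE]; rewrite (inner_ext (g' := T k') (frefl _)).
    by rewrite inner_linl Ti Ta mulN1r addNr.
  by apply: coef_inj => z z1; rewrite Te // kE // normc_lt1.
have [c cE] := choice (fun g => eb _ (pK g)).
have pE g : coef (p g) =1 coef (hsum (c g) e).
  by apply: coef_inj => z z1; rewrite cE ?normc_lt1 // eval_sum.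
have pe g j : hardy_inner (p g) (e j) = c g j.
  rewrite (inner_ext (pE g) (frefl _)) inner_suml (bigD1 j) //= eo eqxx mulr1.
  rewrite big1 ?addr0 // => i ij.
  by rewrite eo (negbTE ij) mulr0.
(* Pythagoras: in the expansion of |g - T (T' g)|^2 every term containing T (T' g) is plus or minus
   |T' g|^2. *)
have inner_split g : hardy_inner g g =
    \sum_(j < M) c g j * (c g j)^* + hardy_inner (T' g) (T' g).
  have <- : hardy_inner (p g) (p g) = \sum_(j < M) c g j * (c g j)^*.
    rewrite (inner_ext (pE g) (frefl _)) inner_suml.
    by apply: eq_bigr => j _; rewrite -[X in _ * X]inner_conj pe.
  rewrite inner_linl !inner_linr Ti rmorphN1 Ta.
  by rewrite -[hardy_inner (T _) g]inner_conj Ta inner_conj; ring.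
pose q g := complex.Re (hardy_inner g g).
have q_ge0 g : 0 <= q g.
  by have := sum_normc_le_inner g 0; rewrite big_ord0.
have q_split g : q g = \sum_(j < M) N (c g j) ^+ 2 + q (T' g).
  rewrite {1}/q inner_split.
  have -> : \sum_(j < M) c g j * (c g j)^* = (\sum_(j < M) N (c g j) ^+ 2)%:C.
    rewrite rmorph_sum /=; apply: eq_bigr => j _.
    by rewrite -normCK normCE -rmorphXn.
  by rewrite /q; case: (hardy_inner _ _).
pose F n := iter n T' f.
have F0 : F 0%N = f by []; have FS n : F n.+1 = T' (F n) by [].
clearbody F.
(* This telescoped identity bounds both the iterates [F n] and the coefficient sequences of
   [h j]. *)
have q_sum n : \sum_(k < n) \sum_(j < M) N (c (F k) j) ^+ 2 + q (F n) = q f.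
  elim: n => [|n IH]; first by rewrite big_ord0 add0r F0.
  by rewrite big_ord_recr /= -addrA FS -q_split.
have qF n : q (F n) <= q f.
  rewrite -(q_sum n) lerDr; apply: sumr_ge0 => k _; apply: sumr_ge0 => j _.
  exact: sqr_ge0.
have c_le j n : \sum_(k < n) N (c (F k) j) ^+ 2 <= q f.
  rewrite -(q_sum n) -[leLHS]addr0 lerD //; apply: ler_sum => k _.
  by rewrite (bigD1 j) //= lerDl sumr_ge0 // => i _; exact: sqr_ge0.
pose h (j : 'I_M) :=
  hardy_of (ex_intro _ (q f) (c_le j) : l2 (fun k => c (F k) j)).
pose H n j := iter n (@hbshift R) (h j).
have HS n j : H n.+1 j = hbshift (H n j) by [].
have coefH n j k : coef (H n j) k = c (F (n + k)%N) j.
  by elim: n k => [|n IH] k //=; rewrite IH addnS.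
have H0 j : H 0%N j = h j by [].
exists h => z z1; under eq_bigr do rewrite -H0.
clearbody h H.
have coefH_le n j m : \sum_(k < m) N (coef (H n j) k) ^+ 2 <= q f.
  apply: le_trans (c_le j (n + m)%N); rewrite big_split_ord /=.
  under eq_bigr do rewrite coefH.
  by rewrite lerDr sumr_ge0 // => k _; rewrite sqr_ge0.
(* Both F n and the tails H n j have bounded norm, so D 0 = b(z)^n D n -> 0. *)
pose D n := F n z - \sum_(j < M) e j z * H n j (b z).
(* The constant terms of the [H n j] reproduce the model-space part of [F n]; what is left on both
   sides carries a factor b(z). *)
have D_rec n : D n = b z * D n.+1.
  have FE : F n z = \sum_(j < M) c (F n) j * e j z + b z * F n.+1 z.
    by rewrite -cE ?normc_lt1 // /p eval_lin // Te // FS; ring.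
  rewrite /D FE mulrBr mulr_sumr.
  have -> : \sum_(j < M) e j z * H n j (b z) = \sum_(j < M) c (F n) j * e j z
      + \sum_(j < M) b z * (e j z * H n.+1 j (b z)).
    rewrite -big_split; apply: eq_bigr => j _ /=.
    by rewrite (eval_recl (H n j)) ?b1 // coefH addn0 HS; ring.
  by ring.
have D_pow n : D 0%N = b z ^+ n * D n.
  by elim: n => [|n IH]; rewrite ?mul1r // IH D_rec exprSr mulrA.
pose B := (q f + (1 - N z ^+ 2)^-1) / 2 +
  \sum_(j < M) N (e j z) * ((q f + (1 - N (b z) ^+ 2)^-1) / 2).
have D_le n : N (D n) <= B.
  apply: le_trans (normcD _ _) _; rewrite normcN lerD //.
    apply: normc_eval_le => // m.
    exact: le_trans (sum_normc_le_inner _ _) (qF n).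
  elim/big_ind2: _ => [|x1 x2 y1 y2 l1 l2|j _].
  - by rewrite ComplexField.Normc.normc0.
  - by apply: le_trans (normcD _ _) _; exact: lerD.
  - rewrite ComplexField.Normc.normcM ler_wpM2l ?normc_ge0 //.
    by apply: normc_eval_le; [exact: coefH_le|exact: b1].
suff : D 0%N = 0 by move/eqP; rewrite subr_eq0 F0 => /eqP.
apply: ComplexField.Normc.eq0_normc; apply/eqP; rewrite eq_le normc_ge0 andbT.
have bz1 : `|N (b z)| < 1 by rewrite ger0_norm ?normc_ge0 // b1.
(* For every n, |D 0| <= B |b(z)|^n, and the right-hand side tends to 0. *)
have /cvg_lim <- // := cvg_geometric B bz1.
apply: limr_ge; first exact: cvgP (cvg_geometric B bz1).
apply: nearW => n; rewrite (D_pow n) ComplexField.Normc.normcM normcX /= mulrC.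
by rewrite ler_wpM2r // exprn_ge0 // normc_ge0.
Qed.

(** The rank-one matrix v^* v splits the product into two scalar sums, which removes matrices from
    the remaining argument. *)
Lemma mulmx_Bmx (M : nat) (v : 'rV[C]_M) (E G : 'I_M -> C) w :
  ((\row_j E j) *m Bmx v w *m (\col_j G j)) 0 0 =
  \sum_(j < M) E j * G j +
  (w - 1) / sqnorm_row v * ((\sum_(j < M) E j * (v 0 j)^* ) *
    (\sum_(j < M) v 0 j * G j)).
Proof.
rewrite /Bmx mulmxDr mulmxDl mulmx1 mxE; congr (_ + _).
  by rewrite mxE; apply: eq_bigr => j _; rewrite !mxE.
rewrite -scalemxAr -scalemxAl mxE mulmxA -[_ *m v *m _]mulmxA mxE big_ord1 !mxE.
congr (_ * (_ * _)); apply: eq_bigr => j _; rewrite !mxE //.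
Qed.

End ModelSpace.

(** * Parametrization of the solutions of the interpolation condition *)

Theorem mainTheorem3 (R : realType) (M : nat) (hM : (0 < M)%N)
    (a : 'I_M -> cplx R) (ha : forall l, `|a l| < 1)
    (kappa : cplx R) (hkappa : `|kappa| = 1)
    (b : cplx R -> cplx R) (hb : b = blaschke kappa a)
    (e : 'I_M -> hardy R) (he : orthonormal_basis (in_model_space b) e)
    (u : 'rV[cplx R]_M) (gamma : cplx R)
    (v : 'rV[cplx R]_M)
    (hv : v = \row_(j < M) \sum_(l < M) u 0 l * e j (a l))
    (hv0 : sqnorm_row v != 0)
    (f : hardy R) :
  \sum_(l < M) u 0 l * f (a l) = gamma
  <->
  exists g : 'I_M -> hardy R, forall z : cplx R, `|z| < 1 ->
    f z = gamma / sqnorm_row v * \sum_(j < M) e j z * (v 0 j)^*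
          + ((\row_(j < M) e j z) *m Bmx v (b z)
               *m (\col_(j < M) g j (b z))) 0 0.
Proof.
have k1 : ComplexField.Normc.normc kappa = 1.
  by apply: (@complexI R); rewrite -normCE hkappa rmorph1.
have a1 l : ComplexField.Normc.normc (a l) < 1 by rewrite -normc_lt1.
have b1 z :
    ComplexField.Normc.normc z < 1 -> ComplexField.Normc.normc (b z) < 1.
  by rewrite hb; exact: blaschke_lt1.
have ba l : b (a l) = 0 by rewrite hb blaschke_zero.
have bm : inner_multiplier b by rewrite hb; exact: inner_multiplier_blaschke.
have sE : sqnorm_row v = \sum_(j < M) v 0 j * (v 0 j)^*.
  by rewrite /sqnorm_row mxE; apply: eq_bigr => j _; rewrite !mxE.
(* Since b vanishes at the nodes, coefficients h_j(b) become constants h_j(0) there; the condition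
   then involves e only through v. *)
have sum_u (G : 'I_M -> cplx R) :
    \sum_(l < M) u 0 l * (\sum_(j < M) e j (a l) * G j) =
    \sum_(j < M) v 0 j * G j.
  under eq_bigr do rewrite mulr_sumr.
  rewrite exchange_big; apply: eq_bigr => j _.
  by rewrite hv mxE mulr_suml; apply: eq_bigr => l _; rewrite mulrA.
split => [fa|[g fE]].
- have [h fE] := model_space_expansion f bm b1 he.
  (* B(w)^-1 = 1 + (1/w - 1) v^* v / (v v^* ) is applied to h minus the
     particular solution; with k = v h, the pole at 0 cancels because k(0) = gamma. *)
  pose k := hsum (v 0) h.
  pose g j := hlin ((v 0 j)^* / sqnorm_row v) (hlin (-1) k (hbshift k)) (h j).
  exists g => z; rewrite normc_lt1 => z1; have bz1 := b1 z z1.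
  have k0 : coef k 0%N = gamma.
    have n0 : ComplexField.Normc.normc (0 : cplx R) < 1.
      by rewrite ComplexField.Normc.normc0.
    rewrite -(eval_at0 k) (eval_sum (v 0) h n0) -(sum_u (fun j => h j 0)) -fa.
    by apply: eq_bigr => l _; rewrite (fE _ (a1 l)) ba.
  have kE' : k (b z) = \sum_(j < M) v 0 j * h j (b z) := eval_sum (v 0) h bz1.
  have kE : k (b z) = gamma + b z * hbshift k (b z)
    by rewrite (eval_recl k bz1) k0.
  clearbody k.
  have gE j : g j (b z) =
      (v 0 j)^* / sqnorm_row v * (hbshift k (b z) - k (b z)) + h j (b z).
    by rewrite /g !eval_lin // mulN1r [- _ + _]addrC.
  rewrite mulmx_Bmx fE //.
  have -> : \sum_(j < M) e j z * g j (b z) =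
      (\sum_(j < M) e j z * (v 0 j)^* ) / sqnorm_row v
        * (hbshift k (b z) - k (b z)) + \sum_(j < M) e j z * h j (b z).
    rewrite !mulr_suml -big_split; apply: eq_bigr => j _ /=.
    by rewrite gE mulrDr !mulrA.
  (* Pairing the correction in g with v gives [hbshift k] - k, while v h = k, so k cancels. *)
  have -> : \sum_(j < M) v 0 j * g j (b z) = hbshift k (b z).
    have -> : \sum_(j < M) v 0 j * g j (b z) =
        sqnorm_row v / sqnorm_row v * (hbshift k (b z) - k (b z)) +
        \sum_(j < M) v 0 j * h j (b z).
      rewrite {1}sE.
      rewrite !mulr_suml -big_split; apply: eq_bigr => j _ /=.
      by rewrite gE mulrDr !mulrA.
    by rewrite divff // mul1r -kE' subrK.
  (* The coefficient of the particular solution is gamma + w [hbshift k] - k at w = b(z), up to the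
     factor 1 / [sqnorm_row v]; it vanishes by [kE]. *)
  by rewrite kE; field.
- have sum_u_lin (c : cplx R) (P Q : 'I_M -> cplx R) :
      \sum_(l < M) u 0 l * (c * P l + Q l) =
      c * (\sum_(l < M) u 0 l * P l) + \sum_(l < M) u 0 l * Q l.
    by rewrite mulr_sumr -big_split; apply: eq_bigr => l _ /=; ring.
  (* At the nodes B(b) is B(0), which annihilates the v^* direction: the contribution V of g is
     subtracted again and gamma alone survives. *)
  pose V := \sum_(j < M) v 0 j * g j 0.
  have faE l : f (a l) =
      (gamma - V) / sqnorm_row v * (\sum_(j < M) e j (a l) * (v 0 j)^* )
      + \sum_(j < M) e j (a l) * g j 0.
    by rewrite fE // mulmx_Bmx ba -/V; ring.
  under eq_bigr do rewrite faE.
  by rewrite sum_u_lin !sum_u -sE -/V; field.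
Qed.
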